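(* Assume $\Sigma=I_p$ and $\beta\sim\mathcal N(0,(r^2/p)I_p)$, with $r^2,\sigma^2>0$ and $\mathrm{SNR}=r^2/\sigma^2$. Let $$S^\star=S^\star(\mathrm{SNR},\gamma):=\frac1{2\gamma}\Big(\mathrm{SNR}(\gamma-1)-\gamma+\sqrt{4\,\mathrm{SNR}\,\gamma^2+(\mathrm{SNR}(\gamma-1)-\gamma)^2}\Big).$$ Let $\mathcal R^\star_{\mathrm{sd}}(\lambda)$ be the limiting optimal self-distilled risk and $\mathcal R^\star$ the limiting risk of optimally tuned ridge (see context). Then $$\lim_{\lambda\to0}\frac{\mathcal R^\star_{\mathrm{sd}}(\lambda)-\mathcal R^\star}{\mathcal R^\star}=\begin{cases}\dfrac{\mathrm{SNR}(1-\gamma)^2+\gamma}{\big(\mathrm{SNR}(1-\gamma)^3+\gamma(1-\gamma^2)\big)(S^\star+1)}-1,&\gamma\in(0,1),\\[3mm]\dfrac{\mathrm{SNR}^2(\gamma-1)^4+\mathrm{SNR}\,\gamma(2\gamma+1)(\gamma-1)^2+\gamma^4}{\big(\mathrm{SNR}\,\gamma(\gamma-1)^3+\gamma^2(\gamma^2-1)\big)(S^\star+1)}-1,&\gamma\in(1,\infty),\end{cases}$$ and, for $\gamma\in(0,\infty)$, $$\lim_{\lambda\to\infty}\frac{\mathcal R^\star_{\mathrm{sd}}(\lambda)-\mathcal R^\star}{\mathcal R^\star}=\frac{\mathrm{SNR}^2\gamma+\mathrm{SNR}(2\gamma+1)+\gamma}{(\mathrm{SNR}(\gamma+1)+\ga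mma)(S^\star+1)}-1.$$
   Context: Setting: $n,p\to\infty$ with $p/n\to\gamma\in(0,\infty)$; $(x_i,y_i)_{i\le n}$ i.i.d. (given $\beta$), $x_i\in\mathbb R^p$ with i.i.d. entries of mean $0$, variance $1$ (covariance $I_p$) and uniformly bounded $(4+\mu)$-th moment, $\mu>0$; $y_i$ has mean $0$ and uniformly bounded $(4+\nu)$-th moment, $\nu>0$; $\beta=\mathbb E[x_iy_i]$ is the (random, isotropic Gaussian, independent of the features) projection coefficient and $\sigma^2=\operatorname{Var}(y_i-x_i^\top\beta)$. Risks are in-distribution squared prediction risks conditional on the training data. Teacher: ridge predictor $f_\lambda(x)=x^\top\arg\min_b\{\|y-Xb\|_2^2/n+\lambda\|b\|_2^2\}$, fitted values $\hat y_\lambda=f_\lambda(X)$; pure-distilled: $f_{\mathrm{pd},\lambda}$ is ridge trained on $(X,\hat y_\lambda)$ with the same $\lambda$; self-distilled: $(1-\xi)f_\lambda+\xi f_{\mathrm{pd},\lambda}$ with $\xi\in\mathbb R$ chosen to minimize the conditional risk. $\mathcal R(\lambda)$ and $\mathcal R^\star_{\mathrm{sd}}(\lambda)$ are the in-probability limits, at fixed $\lambda>0$, of the teacher risk and the optimal self-distilled risk, and $\mathcal R^\star=\min_{\lambda>0}\mathcal R(\lambda)$. Explicitly: let $\kappa=\kappa(\lambda)>0$ solve $\kappa=\lambda+\gamma\kappa/(1+\kappa)$; for $k\in\{2,3,4\}$ let $t_k=\gamma/(1+\kappa)^k$, $q_k=r^2/(1+\kappa)^k$; $b=(1-t_2)^{-1}$,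 $u_2=t_2b$, $u_3=t_3b^3$, $u_4=t_4b^4+2t_3^2b^5$, $E=\kappa-b\lambda+b^2\kappa\lambda t_3$, $a_2=bE^2+b^4\kappa^2\lambda^2t_4+b^5\kappa^2\lambda^2t_3^2$, $a_3=2b^2\kappa\lambda E$, $a_4=b^3\kappa^2\lambda^2$. Then $\mathcal R(\lambda)=\kappa^2bq_2+\sigma^2u_2+\sigma^2$, $\mathcal C(\lambda)=2\kappa^2bq_2-(\kappa bEq_2+\kappa^2b^2\lambda q_3)+\sigma^2(u_2-\lambda u_3)+\sigma^2$, $\mathcal R_{\mathrm{pd}}(\lambda)=4\kappa^2bq_2-2(2\kappa bEq_2+2\kappa^2b^2\lambda q_3)+(a_2q_2+a_3q_3+a_4q_4)+\sigma^2(u_2-2\lambda u_3+\lambda^2u_4)+\sigma^2$, $\mathcal R^\star_{\mathrm{sd}}(\lambda)=\mathcal R(\lambda)-\dfrac{(\mathcal R(\lambda)-\mathcal C(\lambda))^2}{\mathcal R(\lambda)+\mathcal R_{\mathrm{pd}}(\lambda)-2\mathcal C(\lambda)}$. *)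

(* Defs.v *)
From HB Require Import structures.
From mathcomp Require Import all_boot all_order all_algebra.
From mathcomp Require Import all_classical all_reals all_analysis.
From mathcomp Require Import ring lra.
Set Implicit Arguments.
Unset Strict Implicit.
Unset Printing Implicit Defensive.
Import Order.TTheory GRing.Theory Num.Theory.
Import numFieldNormedType.Exports.
Local Open Scope classical_set_scope.
Local Open Scope ring_scope.

Section Risks.
Variable R : realType.

(* The positive root of the fixed-point equation; the default value 0 is never
   used when gamma and lambda are positive (kappa_ex, kappa_uniq). *)
Definition kappa (gamma lambda : R) : R :=
  xget 0 [set k : R | 0 < k /\ k = lambda + gamma * k / (1 + k)].

Lemma kappa_ex (gamma lambda : R) : 0 < lambda ->
  0 < kappa gamma lambda /\
  kappa gamma lambda =
    lambda + gamma * kappa gamma lambda / (1 + kappa gamma lambda).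
Proof.
move=> l0; rewrite /kappa; case: xgetP => [k _ //|noroot].
pose B := 1 - lambda - gamma.
pose D := B ^+ 2 + lambda * 4.
have D_ge0 : 0 <= D by rewrite /D; nra.
pose s := Num.sqrt D.
have s_ge0 : 0 <= s by exact: sqrtr_ge0.
have sE : s ^+ 2 = D by exact: sqr_sqrtr.
have Bs : B < s by rewrite /D in sE; nra.
exfalso; apply: (noroot ((s - B) / 2)); split; first by lra.
have k_gt0 : 0 < (s - B) / 2 by lra.
set k := (s - B) / 2 in k_gt0 *.
have k1 : 1 + k != 0 by rewrite gt_eqF//; lra.
have kE : k * (1 + k) = lambda * (1 + k) + gamma * k.
  have sk : s = 2 * k + B by rewrite /k; field.
  by move: sE; rewrite sk /D /B => sE; lra.
apply: (mulIf k1); rewrite kE; field; exact: k1.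
Qed.

Lemma kappa_uniq (gamma lambda k : R) : 0 < lambda ->
  0 < k -> k = lambda + gamma * k / (1 + k) -> k = kappa gamma lambda.
Proof.
move=> l0 k0 kE; have [] := @kappa_ex gamma lambda l0.
move: (kappa gamma lambda) => h h0 hE.
have clear x : 0 < x -> x = lambda + gamma * x / (1 + x) ->
    x * (1 + x) = lambda * (1 + x) + gamma * x.
  move=> x0 xE; have x1 : 1 + x != 0 by rewrite gt_eqF//; lra.
  by rewrite {1}xE; field.
have kE' := clear _ k0 kE; have hE' := clear _ h0 hE.
have : (k - h) * (k * h + lambda) = 0.
  have -> : (k - h) * (k * h + lambda) =
      h * (k * (1 + k) - (lambda * (1 + k) + gamma * k))
      - k * (h * (1 + h) - (lambda * (1 + h) + gamma * h)) by ring.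
  by rewrite kE' hE' !subrr !mulr0 subrr.
move/eqP; rewrite mulf_eq0 => /orP[|/eqP]; last by nra.
by rewrite subr_eq0 => /eqP.
Qed.

(* In the risks below, r2 and s2 stand for the signal strength r^2 and the
   noise variance sigma^2. *)
Definition tcoef (gamma lambda : R) (k : nat) : R :=
  gamma / (1 + kappa gamma lambda) ^+ k.

Definition qcoef (gamma r2 lambda : R) (k : nat) : R :=
  r2 / (1 + kappa gamma lambda) ^+ k.

Definition bcoef (gamma lambda : R) : R := (1 - tcoef gamma lambda 2)^-1.

Definition u2coef (gamma lambda : R) : R :=
  tcoef gamma lambda 2 * bcoef gamma lambda.

Definition u3coef (gamma lambda : R) : R :=
  tcoef gamma lambda 3 * bcoef gamma lambda ^+ 3.

Definition u4coef (gamma lambda : R) : R :=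
  tcoef gamma lambda 4 * bcoef gamma lambda ^+ 4
  + 2 * tcoef gamma lambda 3 ^+ 2 * bcoef gamma lambda ^+ 5.

Definition Ecoef (gamma lambda : R) : R :=
  let kap := kappa gamma lambda in let b := bcoef gamma lambda in
  kap - b * lambda + b ^+ 2 * kap * lambda * tcoef gamma lambda 3.

Definition a2coef (gamma lambda : R) : R :=
  let kap := kappa gamma lambda in let b := bcoef gamma lambda in
  b * Ecoef gamma lambda ^+ 2
  + b ^+ 4 * kap ^+ 2 * lambda ^+ 2 * tcoef gamma lambda 4
  + b ^+ 5 * kap ^+ 2 * lambda ^+ 2 * tcoef gamma lambda 3 ^+ 2.

Definition a3coef (gamma lambda : R) : R :=
  2 * bcoef gamma lambda ^+ 2 * kappa gamma lambda * lambda
  * Ecoef gamma lambda.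

Definition a4coef (gamma lambda : R) : R :=
  bcoef gamma lambda ^+ 3 * kappa gamma lambda ^+ 2 * lambda ^+ 2.

(* Limiting risk of the ridge teacher. *)
Definition ridge_risk (gamma r2 s2 lambda : R) : R :=
  let kap := kappa gamma lambda in let b := bcoef gamma lambda in
  kap ^+ 2 * b * qcoef gamma r2 lambda 2 + s2 * u2coef gamma lambda + s2.

(* Limiting cross risk between the teacher and the pure-distilled student. *)
Definition cross_risk (gamma r2 s2 lambda : R) : R :=
  let kap := kappa gamma lambda in let b := bcoef gamma lambda in
  let E := Ecoef gamma lambda in let q := qcoef gamma r2 lambda in
  2 * kap ^+ 2 * b * q 2
  - (kap * b * E * q 2 + kap ^+ 2 * b ^+ 2 * lambda * q 3)
  + s2 * (u2coef gamma lambda - lambda * u3coef gamma lambda) + s2.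

(* Limiting risk of the pure-distilled student. *)
Definition pd_risk (gamma r2 s2 lambda : R) : R :=
  let kap := kappa gamma lambda in let b := bcoef gamma lambda in
  let E := Ecoef gamma lambda in let q := qcoef gamma r2 lambda in
  4 * kap ^+ 2 * b * q 2
  - 2 * (2 * kap * b * E * q 2 + 2 * kap ^+ 2 * b ^+ 2 * lambda * q 3)
  + (a2coef gamma lambda * q 2 + a3coef gamma lambda * q 3
     + a4coef gamma lambda * q 4)
  + s2 * (u2coef gamma lambda - 2 * lambda * u3coef gamma lambda
          + lambda ^+ 2 * u4coef gamma lambda)
  + s2.

(* Limiting risk of the optimally mixed self-distilled student: the minimum
   over xi of the limiting risk of (1 - xi) * teacher + xi * student. *)
Definition sd_risk (gamma r2 s2 lambda : R) : R :=
  let T := ridge_risk gamma r2 s2 lambda in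
  let C := cross_risk gamma r2 s2 lambda in
  let P := pd_risk gamma r2 s2 lambda in
  T - (T - C) ^+ 2 / (T + P - 2 * C).

Definition is_min_pos (f : R -> R) (m : R) : Prop :=
  (exists2 l, 0 < l & f l = m) /\ (forall l, 0 < l -> m <= f l).

Definition Sstar (snr gamma : R) : R :=
  (2 * gamma)^-1 *
  (snr * (gamma - 1) - gamma
   + Num.sqrt (4 * snr * gamma ^+ 2 + (snr * (gamma - 1) - gamma) ^+ 2)).

End Risks.

(* Main.v *)
Require Import Defs.
From mathcomp Require Import all_boot all_order all_algebra.
From mathcomp Require Import all_classical all_reals all_analysis.
From mathcomp Require Import ring lra.
Set Implicit Arguments.
Unset Strict Implicit.
Import Order.TTheory GRing.Theory Num.Theory.
Import numFieldNormedType.Exports.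
Local Open Scope classical_set_scope.
Local Open Scope ring_scope.

(** Write g for gamma, k for kappa(lambda), m = 1 + k and D = m^2 - g, and r2,
    s2 for the signal strength and the noise variance.  The fixed-point
    equation gives lambda = k (m - g) / m, so every risk is a rational
    function of k, and b = m^2 / D.  Eliminating lambda yields
      R        = (r2 k^2 + s2 g) / D + s2                     [ridge_riskE]
      R - C    = lambda m^3 (s2 g - r2 lambda) / D^3          [cross_gapE]
      R + Rpd - 2 C = lambda^2 m^4 N / D^5                    [curvatureE]
    with N = r2 ((m - g)^2 + g k^2) + s2 g (m^2 + g) > 0.  The powers of lambda
    cancel in the quotient defining the optimal self-distilled risk, and a
    further factor D disappears, because
      (r2 k^2 + s2 g) N - m^2 (s2 g - r2 lambda)^2
        = g ((r2 k^2 + s2 g)^2 + r2 s2 D^2).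
    Hence, by [sd_riskE], that risk equals
      s2 + g ((r2 k^2 + s2 g)^2 + r2 s2 D^2) / (D N),
    whose limits at both ends of the regularization path are values of this
    rational function: k tends to max(0, g - 1) as lambda tends to 0 and to
    infinity as lambda does.  The second limit is reduced to a continuity
    statement by writing the function homogeneously in projective coordinates
    (k : w), where w = 0 is the point at infinity.

    For the optimal ridge risk, put ks = kappa(g s2 / r2).  Then
      R(lambda) - r2 ks / g = r2 (k - ks)^2 / ((1 + ks) D)    [ridge_gap]
    is nonnegative and vanishes at lambda = g s2 / r2 = g / SNR, so the minimum
    is r2 ks / g; solving the quadratic equation of ks turns it into
    s2 (S + 1) [Sstar_kappa]. *)

(** * The fixed point *)

(** The bound g < 1 + k is what makes D, hence every denominator of the risks,
    positive. *)
Lemma kappa_bounds (R : realType) (g l : R) : 0 < g -> 0 < l ->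
  let k := kappa g l in
  [/\ 0 < k, g < 1 + k & l = k * (1 + k - g) / (1 + k)].
Proof.
move=> g0 l0 k; have [k0 kE] := kappa_ex g l0; rewrite -/k in k0 kE.
have m0 : 1 + k != 0 by rewrite gt_eqF//; lra.
have lE : l = k * (1 + k - g) / (1 + k).
  have -> : l = k - g * k / (1 + k) by rewrite {1}kE; ring.
  by field.
split=> //.
have : 0 < k * (1 + k - g).
  have -> : k * (1 + k - g) = l * (1 + k) by rewrite lE; field.
  by rewrite mulr_gt0//; lra.
by rewrite pmulr_rgt0// subr_gt0.
Qed.

(** The fixed-point equation is quadratic in kappa; its roots have product
    - l, so the positive one carries the positive sign. *)
Lemma kappa_sqrt (R : realType) (g : R) (l : R) : 0 < l ->
  kappa g l = (l + g - 1 + Num.sqrt ((l + g - 1) ^+ 2 + 4 * l)) / 2.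
Proof.
move=> l0; set D := (_ + 4 * l).
have D_ge0 : 0 <= D by rewrite addr_ge0 ?sqr_ge0 ?mulr_ge0 ?ltW.
have sE := sqr_sqrtr D_ge0; have s0 := sqrtr_ge0 D.
set s := Num.sqrt D in sE s0 *.
have As : - (l + g - 1) < s.
  by rewrite /D in sE; move: (l + g - 1) sE => A sE; nra.
have k0 : 0 < (l + g - 1 + s) / 2 by lra.
apply/esym/kappa_uniq => //.
set k := (_ / 2) in k0 *.
have m0 : 1 + k != 0 by rewrite gt_eqF//; lra.
have sk : s = 2 * k - (l + g - 1) by rewrite /k; field.
apply: (mulIf m0).
have -> : (l + g * k / (1 + k)) * (1 + k) = l * (1 + k) + g * k by field.
by move: sE; rewrite sk /D => sE; lra.
Qed.

(** * Closed forms of the risks *)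

(** At w = 1 this is the D of the introduction; the second coordinate w makes it
    homogeneous of degree 2, and likewise for N below. *)
Definition hom_den (R : realType) (g k w : R) : R := (k + w) ^+ 2 - g * w ^+ 2.

(** The numerator N of the curvature in the mixing weight, see [curvatureE]. *)
Definition hom_curv (R : realType) (g r2 s2 k w : R) : R :=
  r2 * ((k + w - g * w) ^+ 2 + g * k ^+ 2)
  + s2 * g * ((k + w) ^+ 2 + g * w ^+ 2).

(** The optimal self-distilled risk at (k : w) = (kappa : 1), in the form of
    degree 0 that extends to the point at infinity (1 : 0). *)
Definition hom_risk (R : realType) (g r2 s2 k w : R) : R :=
  s2 + g * ((r2 * k ^+ 2 + s2 * g * w ^+ 2) ^+ 2 + r2 * s2 * hom_den g k w ^+ 2)
       / (hom_den g k w * hom_curv g r2 s2 k w).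

Section ClosedForms.
Variables (R : realType) (g r2 s2 l : R).
Hypotheses (g0 : 0 < g) (r0 : 0 < r2) (s0 : 0 < s2) (l0 : 0 < l).
Let k := kappa g l.
Let D := hom_den g k 1.

Lemma hom_den_gt0 : 0 < D.
Proof.
rewrite /D /hom_den; have [k0 gk _] := kappa_bounds g0 l0; rewrite -/k in k0 gk.
have -> : (k + 1) ^+ 2 - g * 1 ^+ 2 = (1 + k - g) + k * (1 + k) by ring.
by rewrite addr_gt0 ?subr_gt0 ?mulr_gt0 ?addr_gt0.
Qed.

Let k0 : 0 < k. Proof. by have [] := kappa_bounds g0 l0. Qed.
Let m0 : 1 + k != 0. Proof. by rewrite gt_eqF// addr_gt0. Qed.
Let D0 : (1 + k) ^+ 2 - g != 0.
Proof.
have := lt0r_neq0 hom_den_gt0.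
by rewrite /D /hom_den expr1n mulr1 [k + 1]addrC.
Qed.
Let lE : l = k * (1 + k - g) / (1 + k).
Proof. by have [] := kappa_bounds g0 l0. Qed.

Lemma bcoefE : bcoef g l = (1 + k) ^+ 2 / D.
Proof.
rewrite /bcoef /tcoef /D /hom_den -/k expr1n mulr1 [k + 1]addrC; field.
by rewrite D0 m0.
Qed.

Lemma ridge_riskE : ridge_risk g r2 s2 l = (r2 * k ^+ 2 + s2 * g) / D + s2.
Proof.
rewrite /ridge_risk /u2coef bcoefE /tcoef /qcoef -/k /D /hom_den.
rewrite expr1n mulr1 [k + 1]addrC; field.
by rewrite D0 m0.
Qed.

(** The gap vanishes at l = g * s2 / r2, the optimal ridge penalty: there
    distillation brings no first-order gain. *)
Lemma cross_gapE : ridge_risk g r2 s2 l - cross_risk g r2 s2 l =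
  l * (1 + k) ^+ 3 * (s2 * g - r2 * l) / D ^+ 3.
Proof.
rewrite /cross_risk /ridge_risk /u3coef /Ecoef bcoefE /tcoef /qcoef -/k /D /hom_den.
rewrite expr1n mulr1 [k + 1]addrC lE; field.
by rewrite D0 m0.
Qed.

(** The left-hand side is the quadratic coefficient of the risk in the mixing
    weight.  The factor l ^+ 2 also occurs in the square of the gap of
    [cross_gapE], so it cancels in the quotient of the two, which therefore has
    a limit when l tends to 0. *)
Lemma curvatureE :
  ridge_risk g r2 s2 l + pd_risk g r2 s2 l - 2 * cross_risk g r2 s2 l =
  l ^+ 2 * (1 + k) ^+ 4 * hom_curv g r2 s2 k 1 / D ^+ 5.
Proof.
rewrite /pd_risk /cross_risk /ridge_risk /a2coef /a3coef /a4coef /u4coef.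
rewrite /u3coef /Ecoef bcoefE /tcoef /qcoef -/k /D /hom_den /hom_curv.
rewrite expr1n mulr1 [k + 1]addrC lE; field.
by rewrite D0 m0.
Qed.

Lemma hom_curv_gt0 : 0 < hom_curv g r2 s2 k 1.
Proof.
rewrite ltr_wpDl ?mulr_ge0 ?addr_ge0 ?sqr_ge0 ?mulr_ge0 ?sqr_ge0 ?ltW//.
by rewrite mulr_gt0 ?mulr_gt0// ltr_wpDl ?sqr_ge0// expr1n mulr1.
Qed.

Lemma sd_riskE : sd_risk g r2 s2 l = hom_risk g r2 s2 k 1.
Proof.
rewrite /sd_risk curvatureE cross_gapE ridge_riskE /hom_risk.
(* Only this occurrence of l is eliminated; the other powers of l cancel. *)
have -> : s2 * g - r2 * l = (s2 * g * (1 + k) - r2 * k * (1 + k - g)) / (1 + k).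
  by rewrite {1}lE; field.
have N0 : hom_curv g r2 s2 k 1 != 0 by rewrite gt_eqF ?hom_curv_gt0.
have l0' : l != 0 by rewrite gt_eqF.
move: N0; rewrite /D /hom_den /hom_curv !expr1n !mulr1 [k + 1]addrC => N0.
field.
by rewrite D0 m0 l0' N0.
Qed.

(** Replacing s2 by r2 * ls / g, with ls the optimal penalty written as a function
    of ks, makes the numerator of the gap a quadratic polynomial in k with the
    double root ks. *)
Lemma ridge_gap (ls : R) : ls = g * s2 / r2 ->
  let ks := kappa g ls in
  ridge_risk g r2 s2 l - r2 * ks / g = r2 * (k - ks) ^+ 2 / ((1 + ks) * D).
Proof.
move=> lsE ks.
have ls0 : 0 < ls by rewrite lsE divr_gt0 ?mulr_gt0.
have [ks0 _ ksE] := kappa_bounds g0 ls0; rewrite -/ks in ks0 ksE.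
have n0 : 1 + ks != 0 by rewrite gt_eqF// addr_gt0.
have s2E : s2 = r2 * (ks * (1 + ks - g) / (1 + ks)) / g.
  by rewrite -ksE lsE; field; rewrite !gt_eqF.
rewrite ridge_riskE /D /hom_den expr1n mulr1 [k + 1]addrC s2E; field.
by rewrite n0 D0 gt_eqF.
Qed.

End ClosedForms.

(** * Optimal ridge risk *)

Lemma ridge_risk_min (R : realType) (g r2 s2 : R) :
  0 < g -> 0 < r2 -> 0 < s2 ->
  is_min_pos (ridge_risk g r2 s2) (r2 * kappa g (g * s2 / r2) / g).
Proof.
move=> g0 r0 s0.
have ls0 : 0 < g * s2 / r2 by rewrite divr_gt0 ?mulr_gt0.
split=> [|l l0].
  exists (g * s2 / r2) => //; apply/eqP; rewrite -subr_eq0.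
  by rewrite (ridge_gap g0 r0 s0 ls0 erefl) subrr expr0n mulr0 mul0r.
rewrite -subr_ge0 (ridge_gap g0 r0 s0 l0 erefl).
apply: divr_ge0; first by rewrite mulr_ge0 ?sqr_ge0// ltW.
have [ks0 _ _] := kappa_bounds g0 ls0.
by apply/ltW/mulr_gt0; [exact: addr_gt0|exact: hom_den_gt0].
Qed.

(** Both sides contain the square root of a discriminant: the one in [Sstar] is
    (r2 / s2) ^+ 2 times the one of [kappa_sqrt] at the optimal penalty. *)
Lemma Sstar_kappa (R : realType) (g r2 s2 : R) : 0 < g -> 0 < r2 -> 0 < s2 ->
  s2 * (Sstar (r2 / s2) g + 1) = r2 * kappa g (g * s2 / r2) / g.
Proof.
move=> g0 r0 s0.
have ls0 : 0 < g * s2 / r2 by rewrite divr_gt0 ?mulr_gt0.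
rewrite (kappa_sqrt g ls0) /Sstar.
have -> : 4 * (r2 / s2) * g ^+ 2 + (r2 / s2 * (g - 1) - g) ^+ 2 =
  (r2 / s2) ^+ 2 * ((g * s2 / r2 + g - 1) ^+ 2 + 4 * (g * s2 / r2)).
  by field; rewrite !gt_eqF.
rewrite sqrtrM ?sqr_ge0// sqrtr_sqr ger0_norm ?divr_ge0 ?ltW//.
by field; rewrite !gt_eqF.
Qed.

(** * Limits along the regularization path *)

(** With c = k^-1 this moves the point (k : 1) to (1 : k^-1), which stays bounded
    as k tends to infinity. *)
Lemma hom_risk_scale (R : realType) (g r2 s2 c k w : R) : c != 0 ->
  hom_risk g r2 s2 (c * k) (c * w) = hom_risk g r2 s2 k w.
Proof.
move=> c0; rewrite /hom_risk.
have -> : hom_den g (c * k) (c * w) = c ^+ 2 * hom_den g k w by rewrite /hom_den; ring.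
have -> : hom_curv g r2 s2 (c * k) (c * w) = c ^+ 2 * hom_curv g r2 s2 k w.
  by rewrite /hom_curv; ring.
congr (_ + _); rewrite [in RHS]mulrC.
set X := hom_den _ _ _; set Y := hom_curv _ _ _ _ _.
have -> : g * ((r2 * (c * k) ^+ 2 + s2 * g * (c * w) ^+ 2) ^+ 2 +
    r2 * s2 * (c ^+ 2 * X) ^+ 2) = c ^+ 4 *
   (g * ((r2 * k ^+ 2 + s2 * g * w ^+ 2) ^+ 2 + r2 * s2 * X ^+ 2)) by ring.
have -> : c ^+ 2 * X * (c ^+ 2 * Y) = c ^+ 4 * (X * Y) by ring.
by rewrite -mulf_div divff ?mul1r 1?mulrC// expf_neq0.
Qed.

Lemma cvg_hom_risk (R : realType) (T : Type) (F : set_system T) {FF : Filter F}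
    (g r2 s2 : R) (k w : T -> R) (k0 w0 : R) :
  hom_den g k0 w0 != 0 -> hom_curv g r2 s2 k0 w0 != 0 ->
  k @ F --> k0 -> w @ F --> w0 ->
  hom_risk g r2 s2 (k t) (w t) @[t --> F] --> hom_risk g r2 s2 k0 w0.
Proof.
move=> D0 N0 kF wF.
have sqrF (f : T -> R) (a : R) : f @ F --> a -> f t ^+ 2 @[t --> F] --> a ^+ 2.
  by move=> fa; rewrite expr2; apply: cvgM.
have scaF (c : R) (f : T -> R) (a : R) : f @ F --> a -> c * f t @[t --> F] --> c * a.
  by move=> fa; apply: cvgM => //; exact: cvg_cst.
have kwF : k t + w t @[t --> F] --> k0 + w0 by exact: cvgD.
have DF : hom_den g (k t) (w t) @[t --> F] --> hom_den g k0 w0.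
  apply: cvgB; first exact: sqrF.
  by apply: (scaF); exact: sqrF.
have NF : hom_curv g r2 s2 (k t) (w t) @[t --> F] --> hom_curv g r2 s2 k0 w0.
  apply: cvgD; apply: (scaF); apply: cvgD.
  - by apply: (sqrF); apply: cvgB => //; exact: scaF.
  - by apply: (scaF); exact: sqrF.
  - exact: sqrF.
  - by apply: (scaF); exact: sqrF.
have AF : r2 * k t ^+ 2 + s2 * g * w t ^+ 2 @[t --> F] -->
    r2 * k0 ^+ 2 + s2 * g * w0 ^+ 2.
  by apply: cvgD; apply: (scaF); exact: sqrF.
apply: cvgD; first exact: cvg_cst.
apply: cvgM; last by apply: cvgV; [rewrite mulf_neq0|exact: cvgM].
by apply: (scaF); apply: cvgD; [exact: sqrF|apply: (scaF); exact: sqrF].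
Qed.

(** The limit is the larger root, max(0, g - 1), of the fixed-point equation at
    l = 0, in the form in which [kappa_sqrt] produces it. *)
Lemma cvg_kappa0 (R : realType) (g : R) :
  kappa g l @[l --> 0^'+] --> (g - 1 + `|g - 1|) / 2.
Proof.
apply: cvg_trans.
  apply: (near_eq_cvg (f := fun l => (l + g - 1 + Num.sqrt ((l + g - 1) ^+ 2 + 4 * l)) / 2)).
  by near=> l; rewrite kappa_sqrt.
apply: cvg_at_right_filter.
have lc : (l + g - 1) @[l --> (0 : R)] --> g - 1.
  rewrite -[g in X in _ --> X]add0r; apply: cvgB; last exact: cvg_cst.
  by apply: cvgD; [exact: cvg_id|exact: cvg_cst].
apply: cvgM; last exact: cvg_cst.
apply: cvgD => //; rewrite -sqrtr_sqr.
apply: continuous_cvg; first exact: sqrt_continuous.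
rewrite -[X in _ --> X]addr0 -[0 in X in _ --> X](mulr0 4).
apply: cvgD; first by rewrite expr2; apply: cvgM.
by apply: cvgM; [exact: cvg_cst|exact: cvg_id].
Unshelve. all: by end_near. Qed.

(** The fixed-point equation gives l <= kappa g l. *)
Lemma cvg_kappaV_pinfty (R : realType) (g : R) : 0 < g ->
  (kappa g l)^-1 @[l --> +oo] --> 0.
Proof.
move=> g0; apply/gtr0_cvgV0.
  near=> l; have l0 : 0 < l by near: l; apply: nbhs_pinfty_gt; rewrite num_real.
  by have [] := kappa_ex g l0.
apply/cvgryPge => A; near=> l.
have l0 : 0 < l by near: l; apply: nbhs_pinfty_gt; rewrite num_real.
have [k0 kE] := kappa_ex g l0; rewrite kE.
apply: (@le_trans _ _ l); first by near: l; apply: nbhs_pinfty_ge; rewrite num_real.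
by rewrite lerDl divr_ge0 ?mulr_ge0 ?addr_ge0 ?ltW.
Unshelve. all: by end_near. Qed.

Lemma cvg_sd_risk0 (R : realType) (g r2 s2 k0 : R) :
  0 < g -> 0 < r2 -> 0 < s2 -> k0 = (g - 1 + `|g - 1|) / 2 ->
  hom_den g k0 1 != 0 -> hom_curv g r2 s2 k0 1 != 0 ->
  sd_risk g r2 s2 l @[l --> 0^'+] --> hom_risk g r2 s2 k0 1.
Proof.
move=> g0 rr0 s0 k0E D0 N0; apply: cvg_trans.
  apply: (near_eq_cvg (f := fun l => hom_risk g r2 s2 (kappa g l) 1)).
  by near=> l; rewrite sd_riskE.
apply: cvg_hom_risk => //; last exact: cvg_cst.
by rewrite k0E; exact: cvg_kappa0.
Unshelve. all: by end_near. Qed.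

Section Values.
Variables (R : realType) (g r2 s2 : R).
Hypotheses (g0 : 0 < g) (r0 : 0 < r2) (s0 : 0 < s2).
Let snr := r2 / s2.

Lemma cvg_sd_risk0_under : g < 1 ->
  sd_risk g r2 s2 l @[l --> 0^'+] -->
  s2 * ((snr * (1 - g) ^+ 2 + g) /
        (snr * (1 - g) ^+ 3 + g * (1 - g ^+ 2))).
Proof.
move=> g1; have g1' : 0 < 1 - g by rewrite subr_gt0.
have N0 : 0 < r2 * (1 - g) ^+ 2 + s2 * g * (1 + g).
  have gD : 0 < 1 + g by rewrite addr_gt0.
  by apply: addr_gt0; rewrite !mulr_gt0 ?exprn_gt0.
have D1 : hom_den g 0 1 = 1 - g by rewrite /hom_den; ring.
have N1 : hom_curv g r2 s2 0 1 = r2 * (1 - g) ^+ 2 + s2 * g * (1 + g).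
  by rewrite /hom_curv; ring.
(* Exposing the factors D and N of the target denominator: their positivity
   gives the side conditions of field. *)
have -> : snr * (1 - g) ^+ 3 + g * (1 - g ^+ 2) =
    (1 - g) * (r2 * (1 - g) ^+ 2 + s2 * g * (1 + g)) / s2.
  by rewrite /snr; field; rewrite gt_eqF.
have -> : s2 * ((snr * (1 - g) ^+ 2 + g) /
    ((1 - g) * (r2 * (1 - g) ^+ 2 + s2 * g * (1 + g)) / s2)) =
    hom_risk g r2 s2 0 1.
  by rewrite /hom_risk D1 N1 /snr; field; rewrite !gt_eqF.
apply: cvg_sd_risk0; rewrite ?D1 ?N1 ?gt_eqF//.
by rewrite ltr0_norm ?subr_lt0// subrr mul0r.
Qed.

Lemma cvg_sd_risk0_over : 1 < g ->
  sd_risk g r2 s2 l @[l --> 0^'+] -->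
  s2 * ((snr ^+ 2 * (g - 1) ^+ 4 + snr * g * (2 * g + 1) * (g - 1) ^+ 2
         + g ^+ 4) /
        (snr * g * (g - 1) ^+ 3 + g ^+ 2 * (g ^+ 2 - 1))).
Proof.
move=> g1; have g1' : 0 < g - 1 by rewrite subr_gt0.
have N0 : 0 < r2 * (g - 1) ^+ 2 + s2 * g * (g + 1).
  have gD : 0 < g + 1 by rewrite addr_gt0.
  by apply: addr_gt0; rewrite !mulr_gt0 ?exprn_gt0.
have D1 : hom_den g (g - 1) 1 = g * (g - 1) by rewrite /hom_den; ring.
have N1 : hom_curv g r2 s2 (g - 1) 1 =
    g * (r2 * (g - 1) ^+ 2 + s2 * g * (g + 1)).
  by rewrite /hom_curv; ring.
have -> : snr * g * (g - 1) ^+ 3 + g ^+ 2 * (g ^+ 2 - 1) =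
    g * (g - 1) * (r2 * (g - 1) ^+ 2 + s2 * g * (g + 1)) / s2.
  by rewrite /snr; field; rewrite gt_eqF.
have -> : s2 * ((snr ^+ 2 * (g - 1) ^+ 4
      + snr * g * (2 * g + 1) * (g - 1) ^+ 2 + g ^+ 4) /
    (g * (g - 1) * (r2 * (g - 1) ^+ 2 + s2 * g * (g + 1)) / s2)) =
    hom_risk g r2 s2 (g - 1) 1.
  by rewrite /hom_risk D1 N1 /snr; field; rewrite !gt_eqF.
apply: cvg_sd_risk0; rewrite ?D1 ?N1 ?gt_eqF ?mulr_gt0//.
by rewrite gtr0_norm//; field.
Qed.

Lemma cvg_sd_risk_pinfty :
  sd_risk g r2 s2 l @[l --> +oo] -->
  s2 * ((snr ^+ 2 * g + snr * (2 * g + 1) + g) / (snr * (g + 1) + g)).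
Proof.
have N0 : 0 < r2 * (g + 1) + s2 * g by rewrite addr_gt0 ?mulr_gt0 ?addr_gt0.
have D1 : hom_den g 1 0 = 1 by rewrite /hom_den; ring.
have N1 : hom_curv g r2 s2 1 0 = r2 * (g + 1) + s2 * g.
  by rewrite /hom_curv; ring.
have -> : snr * (g + 1) + g = (r2 * (g + 1) + s2 * g) / s2.
  by rewrite /snr; field; rewrite gt_eqF.
have -> : s2 * ((snr ^+ 2 * g + snr * (2 * g + 1) + g) /
    ((r2 * (g + 1) + s2 * g) / s2)) = hom_risk g r2 s2 1 0.
  by rewrite /hom_risk D1 N1 /snr; field; rewrite !gt_eqF.
apply: cvg_trans.
  apply: (near_eq_cvg (f := fun l => hom_risk g r2 s2 1 (kappa g l)^-1)).
  near=> l; have l0 : 0 < l by near: l; apply: nbhs_pinfty_gt; rewrite num_real.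
  have [k0 _ _] := kappa_bounds g0 l0; have k1 := lt0r_neq0 k0.
  by rewrite sd_riskE// -(hom_risk_scale _ _ _ _ _ k1) mulr1 divff.
apply: cvg_hom_risk; rewrite ?D1 ?N1 ?oner_neq0 ?gt_eqF//.
  exact: cvg_cst.
exact: cvg_kappaV_pinfty.
Unshelve. all: by end_near. Qed.

End Values.

(** Used with c the noise variance and c * d the optimal ridge risk: the limits of
    the risk come in units of c, so c drops out of the relative excess. *)
Lemma cvg_excess (R : realType) (T : Type) (F : set_system T) {FF : Filter F}
    (f : T -> R) (a b c d : R) :
  c != 0 -> d != 0 -> f @ F --> c * (a / b) ->
  (f t - c * d) / (c * d) @[t --> F] --> a / (b * d) - 1.
Proof.
move=> c0 d0 fF.
have -> : a / (b * d) - 1 = (c * (a / b) - c * d) / (c * d).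
  have -> : a / (b * d) = a / b / d by rewrite invfM mulrA.
  by move: (a / b) => x; field; rewrite d0 c0.
by apply: cvgM; [apply: cvgB => //|]; exact: cvg_cst.
Qed.

Theorem proposition3p4 (R : realType) (gamma r sigma : R)
    (gamma_gt0 : 0 < gamma) (r2_gt0 : 0 < r ^+ 2) (sigma2_gt0 : 0 < sigma ^+ 2) :
  let SNR := r ^+ 2 / sigma ^+ 2 in
  let S := Sstar SNR gamma in
  exists Rstar : R,
    is_min_pos (ridge_risk gamma (r ^+ 2) (sigma ^+ 2)) Rstar /\
    (gamma < 1 ->
      (sd_risk gamma (r ^+ 2) (sigma ^+ 2) lambda - Rstar) / Rstar
        @[lambda --> (0 : R)^'+] -->
      (SNR * (1 - gamma) ^+ 2 + gamma) /
      ((SNR * (1 - gamma) ^+ 3 + gamma * (1 - gamma ^+ 2)) * (S + 1)) - 1) /\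
    (1 < gamma ->
      (sd_risk gamma (r ^+ 2) (sigma ^+ 2) lambda - Rstar) / Rstar
        @[lambda --> (0 : R)^'+] -->
      (SNR ^+ 2 * (gamma - 1) ^+ 4
       + SNR * gamma * (2 * gamma + 1) * (gamma - 1) ^+ 2 + gamma ^+ 4) /
      ((SNR * gamma * (gamma - 1) ^+ 3 + gamma ^+ 2 * (gamma ^+ 2 - 1))
       * (S + 1)) - 1) /\
    (sd_risk gamma (r ^+ 2) (sigma ^+ 2) lambda - Rstar) / Rstar
        @[lambda --> +oo] -->
      (SNR ^+ 2 * gamma + SNR * (2 * gamma + 1) + gamma) /
      ((SNR * (gamma + 1) + gamma) * (S + 1)) - 1.
Proof.
move=> SNR S.
move: (r ^+ 2) (sigma ^+ 2) r2_gt0 sigma2_gt0 @SNR @S => r2 s2 r0 s0 SNR S.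
have ls0 : 0 < gamma * s2 / r2 by rewrite divr_gt0 ?mulr_gt0.
have RsE : s2 * (S + 1) = r2 * kappa gamma (gamma * s2 / r2) / gamma.
  exact: Sstar_kappa.
have S0 : S + 1 != 0.
  have : 0 < s2 * (S + 1).
    by rewrite RsE divr_gt0 ?mulr_gt0//; have [] := kappa_bounds gamma_gt0 ls0.
  by rewrite pmulr_rgt0// => /lt0r_neq0.
have s20 := lt0r_neq0 s0.
exists (s2 * (S + 1)); split; first by rewrite RsE; exact: ridge_risk_min.
split; [|split].
- by move=> g1; apply: cvg_excess => //; exact: cvg_sd_risk0_under.
- by move=> g1; apply: cvg_excess => //; exact: cvg_sd_risk0_over.
- by apply: cvg_excess => //; exact: cvg_sd_risk_pinfty.
Qed.
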